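(* Let $Y=f(X,U)$ and $X=g(Z,U)$, where $X$ and $Z$ are real-valued, $X\in\mathbf{X}$ and $Z\in\mathbf{Z}$ for bounded intervals $\mathbf{X},\mathbf{Z}\subset\mathbb{R}$, $f(x,u)$ is smooth in $x$ and $g(z,u)$ is smooth in $z$. Suppose that (i) $Z$ is independent of $U$; (ii) for every $z\in\mathbf{Z}$, $\frac{\partial Y}{\partial X}$ and $\frac{\partial X}{\partial Z}$ are uncorrelated conditional on $Z=z$; (iii) $a(z)\neq 0$ for every $z\in\mathbf{Z}$. Then $\phi(z)=E\left(\frac{\partial Y}{\partial X}\,\middle|\,Z=z\right)$ is identifiable via the equation $$a(z)\,\phi(z)=b(z);$$ that is, for every $z\in\mathbf{Z}$, $\phi(z)$ satisfies this equation and is its unique solution.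
   Context: All random variables are defined on a probability space $(\Omega,\mathcal{A},P)$. $Y$ is real-valued. $U$ is a random element of an arbitrary measurable space $\mathcal{U}$ (all other variables, besides $X$ and $Z$, that may affect $Y$ and $X$), and no restriction is placed on its distribution. $f:\mathbf{X}\times\mathcal{U}\to\mathbb{R}$ and $g:\mathbf{Z}\times\mathcal{U}\to\mathbf{X}$ are measurable; the intervals $\mathbf X,\mathbf Z$ are nondegenerate, with one-sided derivatives at any endpoints they contain. ''Smooth in $x$'' means that $f(x,u)$ has first and second order derivatives in $x$ and that $f$ and these derivatives are uniformly bounded (over all $x$ and $u$); ''smooth in $z$'' for $g(z,u)$ means the same with respect to $z$. Notation: - $h(x,u)=\frac{\partial f}{\partial x}(x,u)$ and $k(z,u)=\frac{\partial g}{\partial z}(z,u)$. - $\frac{\partial Y}{\partial X}$ denotes the random variable $h(X,U)$, and $\frac{\partial X}{\partial Z}$ denotes the random variable $k(Z,U)$. - $b(z)=\frac{d}{dz}E(Y\mid Z=z)$ and $a(z)=\frac{d}{dz}E(X\mid Z=z)$. - $B$ and $C$ are uncorrelated conditional on $Z=z$ if $E(BC\mid Z=z)=E(B\mid Z=z)\,E(C\mid Z=z)$. Convention on conditioning: since $Z$ is independent of $U$, for a bounded measurable function $F$ the conditional expectation $E(F(Z,U)\mid Z=z)$ is taken, for every $z\in\mathbf{Z}$, to be $E(F(z,U))$; in particular $E(X\mid Z=z)=E(g(z,U))$ and $E(Y\mid Z=z)=E(f(g(z,U),U))$. *)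

(* Defs.v *)
From HB Require Import structures.
From mathcomp Require Import all_boot all_order all_algebra.
From mathcomp Require Import all_classical all_reals all_analysis.
Import Order.TTheory GRing.Theory Num.Theory.
Import numFieldNormedType.Exports.

Set Implicit Arguments.
Unset Strict Implicit.
Unset Printing Implicit Defensive.

Local Open Scope classical_set_scope.
Local Open Scope ring_scope.

Definition nondegenerate_set (R : realType) (D : set R) : Prop :=
  exists x y, [/\ D x, D y & x < y].

(* Derivative at x of a function on D: the increments are restricted to
   points of D, so this is the one-sided derivative when D is an interval
   and x is one of its endpoints, and the usual derivative at an interior
   point. The values of F outside D play no role when x is in D. *)
Definition derivable_in (R : realType) (D : set R) (F : R -> R) (x : R) : Prop :=
  cvg ((F y - F x) / (y - x) @[y --> within D x^']).

Definition derive_in (R : realType) (D : set R) (F : R -> R) (x : R) : R :=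
  lim ((F y - F x) / (y - x) @[y --> within D x^']).

Definition smooth_in (R : realType) (V : Type) (D : set R) (F : R -> V -> R) : Prop :=
  [/\ forall v x, D x -> derivable_in D (F ^~ v) x,
      forall v x, D x -> derivable_in D (derive_in D (F ^~ v)) x
    & exists M : R, forall v x, D x ->
        [/\ `|F x v| <= M,
            `|derive_in D (F ^~ v) x| <= M
          & `|derive_in D (derive_in D (F ^~ v)) x| <= M]].

Definition independent_RV d d1 d2 (T : measurableType d) (T1 : measurableType d1)
    (T2 : measurableType d2) (R : realType) (P : probability T R)
    (X1 : {RV P >-> T1}) (X2 : {RV P >-> T2}) : Prop :=
  forall A B, measurable A -> measurable B ->
    (P (X1 @^-1` A `&` X2 @^-1` B) = P (X1 @^-1` A) * P (X2 @^-1` B))%E.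

(* E(F(Z,U) | Z = z) for Z independent of U and F bounded and measurable:
   the version of the conditional expectation that is defined at every z,
   namely E(F(z,U)). *)
Definition cond_exp d dV (T : measurableType d) (V : measurableType dV)
    (R : realType) (P : probability T R) (U : {RV P >-> V})
    (F : R -> V -> R) (z : R) : R :=
  fine ('E_P[fun w => F z (U w)])%E.

Definition uncorrelated_given d dV (T : measurableType d) (V : measurableType dV)
    (R : realType) (P : probability T R) (U : {RV P >-> V})
    (B C : R -> V -> R) (z : R) : Prop :=
  cond_exp U (fun z v => B z v * C z v) z = cond_exp U B z * cond_exp U C z.

Section Model.
Context d dV (T : measurableType d) (V : measurableType dV) (R : realType)
  (P : probability T R) (IX IZ : set R) (f g : R -> V -> R) (U : {RV P >-> V}).

(* X, Y and the random derivatives dY/dX = h(X,U) and dX/dZ = k(Z,U), written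
   as functions of the values of (Z,U). *)
Definition X_of : R -> V -> R := g.

Definition Y_of (z : R) (v : V) : R := f (g z v) v.

Definition dYdX (z : R) (v : V) : R := derive_in IX (f ^~ v) (g z v).

Definition dXdZ (z : R) (v : V) : R := derive_in IZ (g ^~ v) z.

Definition a_coef (z : R) : R := derive_in IZ (cond_exp U X_of) z.

Definition b_coef (z : R) : R := derive_in IZ (cond_exp U Y_of) z.

Definition phi (z : R) : R := cond_exp U dYdX z.

End Model.

(* Main.v *)
(* By the mean value theorem the difference quotients of [g(., u)] and of
   [f(g(., u), u)] are bounded uniformly in [u], so dominated convergence allows
   differentiating under the expectation: [a(z) = E k(z, U)] and, by the chain
   rule, [b(z) = E (h(g(z, U), U) k(z, U))]. The latter factors as
   [phi(z) a(z)] because the two derivatives are uncorrelated given [Z = z]. *)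
Require Import Defs.
From HB Require Import structures.
From mathcomp Require Import all_boot all_order all_algebra.
From mathcomp Require Import all_classical all_reals all_analysis.
From mathcomp Require Import measurable_realfun.
Import Order.TTheory GRing.Theory Num.Theory.
Import numFieldNormedType.Exports.
Local Open Scope classical_set_scope.
Local Open Scope ring_scope.

(** Makes limits along [within D z^'] unique, so that [derive_in] can be computed from a convergence
    statement. Some [t] other than [z] lies in [D], and by convexity [D] contains the points reached
    by moving slightly from [z] towards [t]. *)
Lemma proper_within_dnbhs (R : realType) (D : set R) (z : R) :
  is_interval D -> nondegenerate_set D -> D z -> ProperFilter (within D z^').
Proof.
move=> ivD [x [y [Dx Dy xy]]] Dz.
have [t Dt tz] : exists2 t, D t & t != z.
  have [xz|xz] := eqVneq x z; last by exists x.
  by exists y => //; rewrite -xz gt_eqF.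
apply: Build_ProperFilter_ex => A [e /= e0 zA].
have tz0 : 0 < `|t - z| by rewrite normr_gt0 subr_eq0.
have etz : 0 < e + `|t - z| by rewrite addr_gt0.
(* This choice gives both [s < 1] and [s * |t - z| < e], so the witness below lies between [z] and
   [t] and within [e] of [z], however far away [t] is. *)
pose s := e / (e + `|t - z|).
have s0 : 0 < s by rewrite divr_gt0.
have s1 : s < 1 by rewrite ltr_pdivrMr// mul1r ltrDl.
have zs : s * `|t - z| < e.
  by rewrite mulrAC ltr_pdivrMr// ltr_pM2l// ltrDr.
exists (z + s * (t - z)); apply: zA => /=.
- by rewrite opprD addrA subrr sub0r normrN normrM (gtr0_norm s0).
- by rewrite -[X in _ != X]addr0 (inj_eq (addrI z)) mulf_neq0 ?(gt_eqF s0)// subr_eq0.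
- have [tltz|zltt|tE] := ltgtP t z; last by rewrite tE eqxx in tz.
    apply: (ivD t z) => //; apply/andP; split; last first.
      by rewrite gerDl nmulr_lle0 ?subr_lt0// ltW.
    by rewrite -lerBlDl -[leLHS]mul1r ler_nM2r ?subr_lt0// ltW.
  apply: (ivD z t) => //; apply/andP; split.
    by rewrite lerDl mulr_ge0 ?subr_ge0// ltW.
  by rewrite -lerBrDl -[leRHS]mul1r ler_pM2r ?subr_gt0// ltW.
Qed.

Lemma cvg_seq_within_dnbhs (R : realType) (D : set R) (p : R) (u : R^nat) :
  (forall n, D (u n) /\ u n != p) -> u n @[n --> \oo] --> p ->
  u n @[n --> \oo] --> within D p^'.
Proof.
move=> uD up A pA.
have : \forall n \near \oo, u n != p -> D (u n) -> A (u n).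
  exact: (up (fun x => x != p -> D x -> A x)).
by apply: filterS => n; have [Dun unp] := uD n; apply.
Qed.

(** Reduces limits of difference quotients to sequences, the setting of dominated convergence. If
    the limit fails for some [e], choosing a bad point within [1/(n+1)] of [p] for each [n] yields a
    sequence that contradicts the hypothesis. *)
Lemma cvg_within_dnbhs_seq (R : realType) (D : set R) (F : R -> R) (p l : R) :
  (forall u : R^nat, (forall n, D (u n) /\ u n != p) ->
    u n @[n --> \oo] --> p -> F (u n) @[n --> \oo] --> l) ->
  F x @[x --> within D p^'] --> l.
Proof.
move=> seqF; apply/cvgrPdist_lt => e e0; apply: contrapT => nF.
have bad n : exists x, [/\ D x, x != p, `|p - x| < n.+1%:R^-1 & e <= `|l - F x| ].
  apply: contrapT => /forallNP nbad; apply: nF.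
  exists n.+1%:R^-1 => /=; first by rewrite invr_gt0.
  move=> x px xp Dx; rewrite ltNge; apply/negP => eF.
  exact: (nbad x).
pose u n := sval (cid (bad n)).
have uP n : [/\ D (u n), u n != p, `|p - u n| < n.+1%:R^-1 & e <= `|l - F (u n)| ].
  exact: svalP (cid (bad n)).
have up : u n @[n --> \oo] --> p.
  apply/cvgrPdist_lt => r r0; near=> n.
  have [_ _ + _] := uP n; move/lt_trans; apply.
  by near: n; exact: near_infty_natSinv_lt (PosNum r0).
have /(seqF _) /(_ up) : forall n, D (u n) /\ u n != p by move=> n; have [] := uP n.
move=> /cvgrPdist_lt /(_ _ e0)[n _ /(_ _ (leqnn _))] /=.
by have [_ _ _] := uP n; rewrite leNgt => /negP.
Unshelve. all: by end_near. Qed.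

(** For [y != x], [F y] is [F x] plus the difference quotient times [y - x], and this product tends
    to 0. The filter in the conclusion is not punctured, so [y = x] is treated apart. *)
Lemma derivable_in_cvg (R : realType) (D : set R) (F : R -> R) (x : R) :
  derivable_in D F x -> F y @[y --> within D (nbhs x)] --> F x.
Proof.
move=> dF.
have dx : y - x @[y --> within D x^'] --> 0.
  rewrite -(subrr x); apply: cvgB; last exact: cvg_cst.
  by move=> A /nbhs_dnbhs; apply: filterS => y Ay _.
have : F x + (F y - F x) / (y - x) * (y - x) @[y --> within D x^'] --> F x.
  rewrite -[X in _ --> X]addr0 -[X in _ + X](mulr0 (derive_in D F x)).
  by apply: cvgD; [exact: cvg_cst|exact: cvgM].
move=> cF A FA; have xA : \forall y \near x, y != x -> D y ->
    A (F x + (F y - F x) / (y - x) * (y - x)) by exact: (cF A FA).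
suff : \forall y \near x, D y -> A (F y) by [].
apply: filterS xA => y yA Dy; have [->|yx] := eqVneq y x.
  exact: nbhs_singleton.
by have := yA yx Dy; rewrite divfK ?subr_eq0// subrKC.
Qed.

(** At an interior point the restriction to [D] is eventually vacuous; this gives access to the mean
    value theorem. *)
Lemma is_derive_derive_in (R : realType) (D : set R) (F : R -> R) (x : R) :
  nbhs x D -> derivable_in D F x -> is_derive x 1 F (derive_in D F x).
Proof.
move=> xD dF.
have lF : (F y - F x) / (y - x) @[y --> x^'] --> derive_in D F x.
  move=> A /dF xA.
  have {}xA : \forall y \near x^', D y -> A ((F y - F x) / (y - x)) by exact: xA.
  have xD' : x^' D by exact: nbhs_dnbhs.
  suff : \forall y \near x^', A ((F y - F x) / (y - x)) by [].
  by apply: filterS2 xA xD' => y; apply.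
have lF0 : h^-1 *: ((F \o shift x) (h *: 1) - F x) @[h --> 0^'] --> derive_in D F x.
  apply/cvgr_dnbhsP => u [u0 ucvg].
  have uxF : (F (u n + x) - F x) / (u n + x - x) @[n --> \oo] --> derive_in D F x.
    move/cvgr_dnbhsP : lF; apply; split=> [n|]; first by rewrite -subr_eq0 addrK.
    by rewrite -[X in _ --> X]add0r; apply: cvgD => //; exact: cvg_cst.
  apply: cvg_trans uxF; apply: near_eq_cvg; apply: nearW => n.
  by rewrite /= addrK scaler1 mulrC.
split; first by apply/cvg_ex; exists (derive_in D F x).
exact: cvg_lim lF0.
Qed.

(** The mean value theorem on the segment from [x] to [y] asks for a two-sided derivative only at
    inner points and for continuity relative to the segment elsewhere, so [x] and [y] may be
    endpoints of [D]. *)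
Lemma lipschitz_derive_in (R : realType) (D : set R) (F : R -> R) (M : R) :
  is_interval D -> (forall x, D x -> derivable_in D F x) ->
  (forall x, D x -> `|derive_in D F x| <= M) ->
  forall x y, D x -> D y -> `|F y - F x| <= M * `|y - x|.
Proof.
move=> ivD dF FM x y; wlog xy : x y / x <= y => [H Dx Dy|Dx Dy].
  have [|/ltW] := leP x y; first by move/H; apply.
  by move/H => /(_ Dy Dx); rewrite distrC (distrC x).
have sD t : t \in `[x, y] -> D t by rewrite in_itv => /ivD; apply.
have [||c /sD Dc ->] := @MVT_segment R F (derive_in D F) x y xy.
- move=> t txy; apply: is_derive_derive_in.
    have : \forall s \near t, s \in `]x, y[ by exact: near_in_itvoo.
    by apply: filterS => s /= /subset_itv_oo_cc /sD.
  exact/dF/sD/subset_itv_oo_cc.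
- apply/subspace_continuousP => t txy.
  have txD := derivable_in_cvg _ _ _ _ (dF _ (sD _ txy)).
  apply: (cvg_trans _ txD).
  by apply: cvg_app; apply: within_subset => s; exact: sD.
- by rewrite normrM ler_wpM2r// FM.
Qed.

(** [G y] may equal [G z] for [y] arbitrarily close to [z], so the quotient cannot be split directly
    into two quotients; Carathéodory's factorization avoids the division by [G y - G z]. *)
Lemma chain_rule_in (R : realType) (D E : set R) (F G : R -> R) (z : R) :
  (forall y, E y -> D (G y)) -> E z ->
  derivable_in D F (G z) -> derivable_in E G z ->
  (F (G y) - F (G z)) / (y - z) @[y --> within E z^'] -->
    derive_in D F (G z) * derive_in E G z.
Proof.
move=> GD Ez dF dG.
(* The slope of [F] at [G z], extended by its limit, hence continuous at [G z] relative to [D]. *)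
pose q x := if x == G z then derive_in D F (G z)
  else (F x - F (G z)) / (x - G z).
have qE x : F x - F (G z) = q x * (x - G z).
  rewrite /q; case: eqVneq => [->|xGz]; first by rewrite !subrr mulr0.
  by rewrite divfK// subr_eq0.
have qG : q (G y) @[y --> within E z^'] --> derive_in D F (G z).
  have Gz : G y @[y --> within E z^'] --> within D (nbhs (G z)).
    move=> A GzA.
    have : \forall y \near z, E y -> D (G y) -> A (G y).
      exact: (derivable_in_cvg _ _ _ _ dG (fun x => D x -> A x)).
    move=> /nbhs_dnbhs zA.
    suff : \forall y \near z^', E y -> A (G y) by [].
    by apply: filterS zA => y + Ey; move/(_ Ey); apply; exact: GD.
  apply: cvg_comp Gz _ => A dA.
  have GzA : \forall y \near G z, y != G z -> D y ->
      A ((F y - F (G z)) / (y - G z)) by exact: (dF A dA).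
  suff : \forall y \near G z, D y -> A (q y) by [].
  apply: filterS GzA => y + Dy; rewrite /q; case: eqVneq => [_ _|yGz]; last exact.
  exact: nbhs_singleton.
under eq_fun do rewrite qE -mulrA.
exact: cvgM.
Qed.

Section expectation_derivative.
Local Open Scope ereal_scope.

(** Differentiation under the expectation: the constant [L] dominates the difference quotients,
    while the bound [M] makes each [F x] integrable. *)
Lemma derive_cond_exp d dV (T : measurableType d) (V : measurableType dV)
    (R : realType) (P : probability T R) (U : {RV P >-> V}) (D : set R)
    (F : R -> V -> R) (K : V -> R) (M L z : R) :
  (forall x, D x -> measurable_fun [set: V] (F x)) ->
  (forall x v, D x -> (`|F x v| <= M)%R) ->
  (forall x v, D x -> (`|F x v - F z v| <= L * `|x - z|)%R) ->
  D z ->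
  (forall v, ((F x v - F z v) / (x - z))%R @[x --> within D z^'] --> K v) ->
  ((cond_exp U F x - cond_exp U F z) / (x - z))%R @[x --> within D z^'] -->
    fine 'E_P[fun w => K (U w)].
Proof.
move=> mF FM FL Dz FK.
have mFU x : D x -> measurable_fun [set: T] (fun w => F x (U w)).
  by move=> Dx; apply: measurableT_comp (mF _ Dx) _.
have iF x : D x -> P.-integrable [set: T] (fun w => (F x (U w))%:E).
  move=> Dx; apply: measurable_bounded_integrable => //; [|exact: mFU|].
    by rewrite (le_lt_trans (probability_le1 _ _)) ?ltry.
  exists M; split; first exact: num_real.
  by move=> N MN w _; apply: le_trans (FM _ _ Dx) (ltW MN).
apply: cvg_within_dnbhs_seq => u uD uz.
pose q n w := ((F (u n) (U w) - F z (U w)) / (u n - z))%R.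
have Du n : D (u n) by have [] := uD n.
have mq n : measurable_fun [set: T] (fun w => (q n w)%:E).
  apply/measurable_EFinP; apply: measurable_funM; last exact: measurable_cst.
  by apply: measurable_funB; exact: mFU.
have qK w : (q n w)%:E @[n --> \oo] --> (K (U w))%:E.
  apply: cvg_EFin; first exact: nearW.
  exact: cvg_comp (cvg_seq_within_dnbhs _ _ _ _ uD uz) (FK (U w)).
(* Measurability of the limit is inherited from the quotients along the sequence. *)
have mK : measurable_fun [set: T] (fun w => (K (U w))%:E).
  by apply: (emeasurable_fun_cvg _ _ mq) => w _; exact: qK.
have qL w n : [set: T] w -> `|(q n w)%:E| <= (EFin \o cst L) w.
  move=> _; rewrite lee_fin normrM normfV ler_pdivrMr ?FL//.
  by rewrite normr_gt0 subr_eq0; have [] := uD n.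
have [iK _ cvgq] := @dominated_convergence _ _ _ P _ measurableT
  (fun n w => (q n w)%:E) (fun w => (K (U w))%:E) (EFin \o cst L) mq mK
  (aeW _ (fun w _ => qK w))
  (finite_measure_integrable_cst P L measurableT) (aeW _ qL).
have -> : fine 'E_P[fun w => K (U w)] = fine (\int[P]_w (K (U w))%:E).
  by rewrite unlock.
(* By linearity the quotient of the expectations is the expectation of the quotient; integrability
   makes all values finite, so [fine] commutes with the operations. *)
have qE n : ((cond_exp U F (u n) - cond_exp U F z) / (u n - z))%R =
    fine (\int[P]_w (q n w)%:E).
  rewrite /cond_exp unlock.
  rewrite [in RHS]/q; under [in RHS]eq_integral do rewrite EFinM EFinB.
  rewrite integralZr//; last by apply: integrableB => //; exact: iF.
  rewrite integralB//; [|exact: iF..].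
  rewrite fineM//; last first.
    by rewrite fin_numB !integrable_fin_num//; exact: iF.
  by rewrite [in RHS]fineB//; apply: integrable_fin_num => //; exact: iF.
under eq_fun do rewrite qE.
apply: fine_cvg.
rewrite fineK//; exact: integrable_fin_num.
Qed.

End expectation_derivative.

Theorem theorem3 (d dV : measure_display) (T : measurableType d)
    (V : measurableType dV) (R : realType) (P : probability T R)
    (IX IZ : set R) (f g : R -> V -> R)
    (X Y Z : {RV P >-> R}) (U : {RV P >-> V})
    (IX_interval : is_interval IX) (IX_bounded : bounded_set IX)
    (IX_nondeg : nondegenerate_set IX)
    (IZ_interval : is_interval IZ) (IZ_bounded : bounded_set IZ)
    (IZ_nondeg : nondegenerate_set IZ)
    (f_meas : measurable_fun (IX `*` [set: V]) (fun p : R * V => f p.1 p.2))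
    (g_meas : measurable_fun (IZ `*` [set: V]) (fun p : R * V => g p.1 p.2))
    (g_maps : forall z v, IZ z -> IX (g z v))
    (f_smooth : smooth_in IX f) (g_smooth : smooth_in IZ g)
    (X_in : forall w, IX (X w)) (Z_in : forall w, IZ (Z w))
    (Y_eq : forall w, Y w = f (X w) (U w))
    (X_eq : forall w, X w = g (Z w) (U w))
    (ZU_indep : independent_RV Z U)
    (uncorr : forall z, IZ z -> uncorrelated_given U (dYdX IX f g) (dXdZ IZ g) z)
    (a_neq0 : forall z, IZ z -> a_coef IZ g U z != 0) :
  forall z, IZ z ->
    [/\ derivable_in IZ (cond_exp U (X_of g)) z,
        derivable_in IZ (cond_exp U (Y_of f g)) z,
        a_coef IZ g U z * phi IX f g U z = b_coef IZ f g U z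
      & forall c : R, a_coef IZ g U z * c = b_coef IZ f g U z ->
          c = phi IX f g U z].
Proof.
move=> z Dz.
have [df _ [Mf fM]] := f_smooth.
have [dg _ [Mg gM]] := g_smooth.
have FF := proper_within_dnbhs R IZ z IZ_interval IZ_nondeg Dz.
have mIX : measurable (IX `*` [set: V]).
  by apply: measurableX => //; exact: is_interval_measurable.
have mIZ : measurable (IZ `*` [set: V]).
  by apply: measurableX => //; exact: is_interval_measurable.
have mg y : IZ y -> measurable_fun [set: V] (g y).
  move=> Dy; have := measurable_comp mIZ _ g_meas (pair1_measurable y).
  by apply=> _ [v _ <-].
(* Composition of [f] with [v] mapped to [(g y v, v)], which stays in the set where [f] is known to
   be measurable. *)
have mf y : IZ y -> measurable_fun [set: V] (Y_of f g y).
  move=> Dy.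
  have := measurable_comp mIX _ f_meas
    (measurable_fun_pair (mg y Dy) (@measurable_id _ _ setT)).
  by apply=> _ [v _ <-]; split => //; exact: g_maps.
have g_lip y v : IZ y -> `|g y v - g z v| <= Mg * `|y - z|.
  move=> Dy; apply: (lipschitz_derive_in R IZ (g ^~ v)) => //.
  - by move=> x; exact: dg.
  - by move=> x Dx; have [] := gM v x Dx.
have f_lip y v : IZ y -> `|Y_of f g y v - Y_of f g z v| <= Mf * Mg * `|y - z|.
  move=> Dy; have := lipschitz_derive_in R IX (f ^~ v) Mf IX_interval
    (df v) _ (g z v) (g y v) (g_maps _ _ Dz) (g_maps _ _ Dy).
  have IXM x : IX x -> `|derive_in IX (f ^~ v) x| <= Mf.
    by move=> Dx; have [] := fM v x Dx.
  move=> /(_ IXM)/le_trans; apply; rewrite -mulrA ler_wpM2l ?g_lip//.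
  (* [Mf] is nonnegative because it bounds an absolute value at [g z v]. *)
  exact: le_trans (normr_ge0 _) (IXM _ (g_maps z v Dz)).
have cvga : (cond_exp U (X_of g) y - cond_exp U (X_of g) z) / (y - z)
    @[y --> within IZ z^'] --> cond_exp U (dXdZ IZ g) z.
  apply: (derive_cond_exp _ _ _ _ _ _ U IZ (X_of g) (dXdZ IZ g z) Mg Mg) => //.
  - by move=> x v Dx; have [] := gM v x Dx.
  - by move=> v; exact: dg.
have cvgb : (cond_exp U (Y_of f g) y - cond_exp U (Y_of f g) z) / (y - z)
    @[y --> within IZ z^'] -->
    cond_exp U (fun z v => dYdX IX f g z v * dXdZ IZ g z v) z.
  apply: (derive_cond_exp _ _ _ _ _ _ U IZ (Y_of f g)
    (fun v => dYdX IX f g z v * dXdZ IZ g z v) Mf (Mf * Mg)) => //.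
  - by move=> x v Dx; have [] := fM v _ (g_maps x v Dx).
  - move=> v; apply: (chain_rule_in R IX IZ (f ^~ v) (g ^~ v)) => //.
    + by move=> y; exact: g_maps.
    + exact/df/g_maps.
    + exact: dg.
have aE : a_coef IZ g U z = cond_exp U (dXdZ IZ g) z by exact: cvg_lim cvga.
have bE : b_coef IZ f g U z = a_coef IZ g U z * phi IX f g U z.
  (* Uncorrelatedness is used here, to turn the product of expectations into the expectation of the
     product, which is the limit in [cvgb]. *)
  rewrite aE mulrC -(uncorr z Dz); exact: cvg_lim cvgb.
split => //.
- by apply/cvg_ex; eexists; exact: cvga.
- by apply/cvg_ex; eexists; exact: cvgb.
- by move=> c; rewrite bE; exact/mulfI/a_neq0.
Qed.
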